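(* Let $a$ be a real number with $a\ne 0$ and let $n$ be a positive integer. Then $$\sum_{k=1}^n\binom{2n}{2k}5^{2k}E_{2n-2k,a}=\frac{2\cdot 4^{2n}}{a}+\frac{(3a^2-8a+4)2^{2n+1}}{a^3}+\frac{4(a-1)3^{2n}}{a^2}+\frac{8(a-1)(a^2-4a+2)}{a^4}-\frac{(5a^2-10a+4)^2}{a^5}E_{2n,a}.$$
   Context: For a real number $a$, the sequence $\{E_{n,a}\}$ is defined by $E_{0,a}=1$ and $E_{n,a}=-a\sum_{k=1}^{\lfloor n/2\rfloor}\binom{n}{2k}E_{n-2k,a}$ for $n\ge 1$. *)

(* Defs.v *)
From mathcomp Require Import all_boot all_order all_algebra.
From mathcomp Require Import reals.

Set Implicit Arguments.
Unset Strict Implicit.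
Unset Printing Implicit Defensive.

Import GRing.Theory.
Local Open Scope ring_scope.

(* The recursion for E_{n,a} refers to all smaller indices, so we build the
   list [:: E_{0,a}; ...; E_{n,a}]; the defining equations are [E_0] and
   [E_rec] below. *)
Fixpoint E_list (R : realType) (a : R) (n : nat) : seq R :=
  if n is m.+1 then
    let s := E_list a m in
    rcons s (- a * \sum_(1 <= k < (m.+1)./2.+1)
                      'C(m.+1, 2 * k)%:R * s`_(m.+1 - 2 * k))
  else [:: 1].

Definition E (R : realType) (n : nat) (a : R) : R := (E_list a n)`_n.

Lemma size_E_list (R : realType) (a : R) (n : nat) :
  size (E_list a n) = n.+1.
Proof. by elim: n => //= n IHn; rewrite size_rcons IHn. Qed.

Lemma nth_E_list (R : realType) (a : R) (n i : nat) :
  (i <= n)%N -> (E_list a n)`_i = E i a.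
Proof.
elim: n => [|n IHn]; first by rewrite leqn0 => /eqP ->.
rewrite leq_eqVlt => /orP[/eqP -> //|lt_in].
by rewrite /= nth_rcons size_E_list lt_in IHn.
Qed.

Lemma E_0 (R : realType) (a : R) : E 0 a = 1.
Proof. by []. Qed.

Lemma E_rec (R : realType) (a : R) (n : nat) : (1 <= n)%N ->
  E n a = - a * \sum_(1 <= k < n./2.+1) 'C(n, 2 * k)%:R * E (n - 2 * k) a.
Proof.
case: n => [//|n] _.
rewrite {1}/E /= nth_rcons size_E_list ltnn eqxx.
congr (_ * _); apply: eq_big_nat => k /andP[k_gt0 _].
by rewrite nth_E_list //; case: k k_gt0 => // k _; rewrite mulnS subSS leq_subr.
Qed.

(* Main.v *)
Require Import Defs.
From HB Require Import structures.
From mathcomp Require Import all_boot all_order all_algebra.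
From mathcomp Require Import reals.
From mathcomp Require Import ring.
Import GRing.Theory Num.Theory.
Local Open Scope ring_scope.

(** Let [L] be the linear functional with [L(X^n) = E_{n,a}] (the umbral
    calculus). The defining recurrence of [E] says that
    [a (L(p(X+1)) + L(p(X-1))) = 2 (p(0) + (a-1) L(p))] for monomials [p], hence
    for all polynomials [p]. Applied to [p = (X+x)^N + (X-x)^N] with [N = 2n]
    this is a Chebyshev-like three-term recurrence in [x] for
    [S(x) = \sum_k C(N,2k) x^(2k) E_{N-2k,a}], and four steps of it lead from
    [S(0)] and [S(1)] to [S(5)]. *)

Lemma sum_nat_even {V : nmodType} (F : nat -> V) (n : nat) :
  (forall i, odd i -> F i = 0) ->
  \sum_(0 <= i < n.+1) F i = \sum_(0 <= k < n./2.+1) F (2 * k)%N.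
Proof.
move=> F0; elim: n => [|n IHn]; first by rewrite !big_nat1 muln0.
rewrite big_nat_recr //= IHn uphalf_half; case: (boolP (odd n)) => oddn.
  rewrite add1n [RHS]big_nat_recr //=; congr (_ + F _).
  by rewrite mul2n doubleS -[in LHS](odd_double_half n) oddn.
by rewrite add0n F0 ?addr0 //= oddn.
Qed.

Lemma exprD_exprB {R : comNzRingType} (x y : R) (n : nat) :
  (x + y) ^+ n + (x - y) ^+ n =
  \sum_(0 <= k < n./2.+1)
     2%:R * 'C(n, 2 * k)%:R * y ^+ (2 * k) * x ^+ (n - 2 * k).
Proof.
(* The factor [1 + (-1) ^+ i] is 2 for even [i] and 0 for odd [i], so only the even terms
   survive. *)
pose F i := (1 + (-1) ^+ i) * 'C(n, i)%:R * y ^+ i * x ^+ (n - i).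
transitivity (\sum_(0 <= i < n.+1) F i).
  rewrite big_mkord !exprDn -big_split; apply: eq_bigr => i _ /=.
  rewrite exprNn -mulrnDl -mulr_natr /F.
  move: (x ^+ _) (y ^+ _) ((-1) ^+ _) ('C(n, i)%:R) => X Y S C.
  ring.
rewrite sum_nat_even => [|i oddi].
  by apply: eq_bigr => k _; rewrite /F exprM sqrrN !expr1n.
by rewrite /F -signr_odd oddi expr1 subrr !mul0r.
Qed.

Definition umbral {R : comNzRingType} (u : nat -> R) (p : {poly R}) : R :=
  \sum_(i < size p) p`_i * u i.

(** Coefficients beyond the size vanish. The free bound lets [p], [q] and [c *: p + q] share one
    index range when linearity is checked. *)
Lemma umbral_widen {R : comNzRingType} (u : nat -> R) (p : {poly R}) (n : nat) :
  (size p <= n)%N -> umbral u p = \sum_(i < n) p`_i * u i.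
Proof.
move=> le_pn; rewrite /umbral (big_ord_widen _ (fun i => p`_i * u i) le_pn).
rewrite big_mkcond; apply: eq_bigr => i _.
by case: ltnP => // le_pi; rewrite nth_default ?mul0r.
Qed.

Lemma umbral_is_linear {R : comNzRingType} (u : nat -> R) :
  linear_for *%R (umbral u).
Proof.
move=> c p q; pose n := maxn (size p) (maxn (size q) (size (c *: p + q))).
rewrite !(@umbral_widen _ _ _ n) ?leq_max ?leqnn ?orbT //.
rewrite mulr_sumr -big_split; apply: eq_bigr => i _ /=.
by rewrite coefD coefZ mulrDl mulrA.
Qed.

HB.instance Definition _ {R : comNzRingType} (u : nat -> R) :=
  GRing.isLinear.Build R {poly R} R *%R (umbral u) (umbral_is_linear u).

Lemma umbralXn {R : comNzRingType} (u : nat -> R) (n : nat) :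
  umbral u 'X^n = u n.
Proof.
rewrite (@umbral_widen _ _ _ n.+1) ?size_polyXn // big_ord_recr /= big1.
  by rewrite add0r coefXn eqxx mul1r.
by move=> i _; rewrite coefXn ltn_eqF ?mul0r.
Qed.

Lemma umbral_exprD_exprB {R : comNzRingType} (u : nat -> R) (x : R) (n : nat) :
  umbral u (('X + x%:P) ^+ n + ('X - x%:P) ^+ n) =
  2%:R * \sum_(0 <= k < n./2.+1)
            'C(n, 2 * k)%:R * x ^+ (2 * k) * u (n - 2 * k)%N.
Proof.
rewrite exprD_exprB linear_sum mulr_sumr; apply: eq_bigr => k _ /=.
rewrite -!polyCMn -polyC_exp -!polyCM mul_polyC linearZ /= umbralXn.
by rewrite !mulrA.
Qed.

(** Adding the term [k = 0] to the recursion turns [- E n a] into [(a - 1) * E n a]. The Kronecker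
    term corrects [n = 0], where the recursion fails; it is the value of ['X^n] at 0. *)
Lemma E_sum {R : realType} (a : R) (n : nat) :
  a * \sum_(0 <= k < n./2.+1) 'C(n, 2 * k)%:R * E (n - 2 * k) a =
  (n == 0%N)%:R + (a - 1) * E n a.
Proof.
rewrite big_nat_recl // muln0 bin0 subn0 mul1r.
case: n => [|n]; first by rewrite big_nil E_0 addr0 !mulr1 addrC subrK.
rewrite [in RHS]mulrBl mul1r {3}E_rec // big_add1.
by rewrite add0r mulNr opprK mulrDr.
Qed.

Lemma umbral_shift {R : realType} (a : R) (p : {poly R}) :
  let L := umbral (fun i => E i a) in
  a * (L (p \Po ('X + 1)) + L (p \Po ('X - 1))) =
  2%:R * (p.[0] + (a - 1) * L p).
Proof.
move=> L; rewrite /L -[p]coefK poly_def -/L.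
apply: (big_ind (fun q => a * (L (q \Po ('X + 1)) + L (q \Po ('X - 1))) =
  2%:R * (q.[0] + (a - 1) * L q))) => [|q r|i _]; rewrite /L.
- by rewrite !comp_poly0 horner0 linear0; ring.
- move=> IHq IHr; rewrite !comp_polyD hornerD !linearD /=.
  by rewrite addrACA mulrDr IHq IHr; ring.
rewrite !comp_polyZ !comp_Xn_poly hornerZ hornerXn !linearZ /= umbralXn.
(* For a monomial, the two shifts are the case [x = 1] of [umbral_exprD_exprB], which reduces the
   claim to [E_sum]. *)
rewrite -mulrDr -linearD /= -[1]/(1%:P) umbral_exprD_exprB expr0n.
under eq_bigr do rewrite expr1n mulr1.
by rewrite mulrCA (mulrCA a) E_sum; ring.
Qed.

Lemma even_binomial_E_rec {R : realType} (a : R) (n : nat) (x : R) :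
  let S y := \sum_(0 <= k < n.+1)
               'C(2 * n, 2 * k)%:R * y ^+ (2 * k) * E (2 * n - 2 * k) a in
  a * (S (x + 1) + S (x - 1)) = 2%:R * (x ^+ (2 * n) + (a - 1) * S x).
Proof.
move=> S; pose p y := ('X + y%:P) ^+ (2 * n) + ('X - y%:P) ^+ (2 * n) : {poly R}.
have Lp y : umbral (fun i => E i a) (p y) = 2%:R * S y.
  by rewrite umbral_exprD_exprB mul2n doubleK -mul2n.
(* The shifts produce four powers, with bases ['X] plus or minus [x] plus or minus 1; pairing
   opposite offsets gives [p (x + 1)] and [p (x - 1)]. *)
have p_shift : (p x \Po ('X + 1)) + (p x \Po ('X - 1)) = p (x + 1) + p (x - 1).
  rewrite /p !comp_polyD !rmorphXn /= !(comp_polyB, comp_polyD) !comp_polyX.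
  rewrite !comp_polyC !(polyCD, polyCN) polyC1 !opprD opprK !addrA.
  rewrite !(addrAC 'X 1) !(addrAC 'X (-1)) addrAC [RHS]addrAC.
  by congr (_ + _); exact: addrAC.
have p0 : (p x).[0] = 2%:R * x ^+ (2 * n).
  by rewrite !(hornerE, horner_exp) !exprM sqrrN mulr_natl.
have := umbral_shift a (p x).
rewrite /= -linearD p_shift linearD /= !Lp p0 -mulrDr => eqS.
apply: (@mulfI _ 2%:R); first by rewrite pnatr_eq0.
rewrite mulrCA eqS; ring.
Qed.

Theorem theorem2p6 (R : realType) (a : R) (n : nat) (a_neq0 : a != 0)
    (n_gt0 : (0 < n)%N) :
  \sum_(1 <= k < n.+1)
      'C(2 * n, 2 * k)%:R * 5%:R ^+ (2 * k) * E (2 * n - 2 * k) a =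
    2%:R * 4%:R ^+ (2 * n) / a
    + (3%:R * a ^+ 2 - 8%:R * a + 4%:R) * 2%:R ^+ (2 * n + 1) / a ^+ 3
    + 4%:R * (a - 1) * 3%:R ^+ (2 * n) / a ^+ 2
    + 8%:R * (a - 1) * (a ^+ 2 - 4%:R * a + 2%:R) / a ^+ 4
    - (5%:R * a ^+ 2 - 10%:R * a + 4%:R) ^+ 2 / a ^+ 5 * E (2 * n) a.
Proof.
pose S y := \sum_(0 <= k < n.+1)
  'C(2 * n, 2 * k)%:R * y ^+ (2 * k) * E (2 * n - 2 * k) a.
have S_rec x : S (x + 1) = 2%:R / a * (x ^+ (2 * n) + (a - 1) * S x) - S (x - 1).
  apply: (addIr (S (x - 1))); rewrite subrK; apply: (mulfI a_neq0).
  by rewrite even_binomial_E_rec mulrA mulrCA divff // mulr1.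
have S_head y : S y = E (2 * n) a + \sum_(1 <= k < n.+1)
    'C(2 * n, 2 * k)%:R * y ^+ (2 * k) * E (2 * n - 2 * k) a.
  by rewrite /S big_ltn // muln0 bin0 subn0 !mul1r.
have S0 : S 0 = E (2 * n) a.
  rewrite S_head big_nat big1 ?addr0 // => k /andP[k_gt0 _].
  by rewrite expr0n muln_eq0 /= eqn0Ngt k_gt0 mulr0 mul0r.
(* At 1 all powers of [y] disappear and [S 1] is the sum in [E_sum], whose Kronecker term is 0
   because [n] is positive. *)
have S1 : S 1 = (a - 1) / a * E (2 * n) a.
  apply: (mulfI a_neq0); rewrite mulrA mulrCA divff // mulr1.
  have half2n : (2 * n)./2 = n by rewrite mul2n doubleK.
  have := E_sum a (2 * n).
  rewrite muln_eq0 /= eqn0Ngt n_gt0 add0r half2n => <-.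
  by congr (_ * _); apply: eq_bigr => k _; rewrite expr1n mulr1.
have step (m : nat) : S m.+2%:R =
    2%:R / a * (m.+1%:R ^+ (2 * n) + (a - 1) * S m.+1%:R) - S m%:R.
  by have := S_rec m.+1%:R; rewrite natr1 -[in S (_ - 1)]natr1 addrK.
(* The sum in the goal starts at [k = 1]; adding its missing term [E (2 * n) a] makes it [S 5]. *)
apply: (addrI (E (2 * n) a)); rewrite -S_head.
rewrite !step S1 S0 expr1n (exprD _ (2 * n) 1).
(* With the powers and [E (2 * n) a] abstracted, what remains is a rational identity in [a] that is
   linear in them. *)
move: (4%:R ^+ _) (3%:R ^+ _) (2%:R ^+ (2 * n)) (E _ _) => p4 p3 p2 e.
by field.
Qed.
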